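(* Let $\Pi$ be an LCL problem on a family of graphs of bounded degree. If $\mathsf{MRad}$ of $\Pi$ is $\Theta(n)$, then $\exists\mathsf{MVol}$, $\mathsf{EMVol}$, $\mathsf{DMVol}$ and $|N_{\mathsf{MRad}}|$ are all $\Theta(n)$ as well; if $\mathsf{MRad}$ of $\Pi$ is $O(1)$, then $\exists\mathsf{MVol}$, $\mathsf{EMVol}$, $\mathsf{DMVol}$ and $|N_{\mathsf{MRad}}|$ are all $O(1)$ as well. Consequently, for every LCL problem on paths and cycles, the five measures $\mathsf{MRad}$, $\exists\mathsf{MVol}$, $\mathsf{EMVol}$, $\mathsf{DMVol}$, $|N_{\mathsf{MRad}}|$ are asymptotically equivalent.
   Context: All graphs have maximum degree bounded by a constant. An LCL problem $\Pi=(\Sigma,\mathcal G,\phi)$ consists of a finite label set $\Sigma$, a class $\mathcal G$ of input graphs, and a local verifier $\phi$ of constant radius $r$: $\phi(G,\lambda,v)\in\{\text{happy},\text{unhappy}\}$ depends only on the isomorphism type of the labeled radius-$r$ neighborhood of $v$. A partial solution is a labeling $\lambda:V(G)\to\Sigma\sqcup\{\bot\}$ such that every vertex with no $\bot$ within distance $r$ is happy. A hole is a vertex labeled $\bot$. A mend of $\lambda$ at a hole $v$ is a partial solution $\lambda'$ with $\lambda'(v)\neq\bot$ and $\lambda'(u)\neq\bot$ whenever $\lambda(u)\ne\bot$. Mends are assumed to always exist. $\exists\mathsf{MVol}$ (existential mending volume), on $n$-vertex instances: $\max_{G,\lambda,v}\min\{|\{u:\lambda(u)\neq\lambda'(u)\}|:\lambda'\text{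 mend of }\lambda\text{ at }v\}$. A set $W\subseteq V(G)$ contains a mend of $\lambda$ at $v$ if some mend $\lambda'$ of $\lambda$ at $v$ satisfies $\{u:\lambda'(u)\ne\lambda(u)\}\subseteq W$. A (local) mender $\mathcal M$ assigns to each $(G,\lambda,v)$ a Markov chain $\mathcal M_{G,\lambda,v}$ on subsets of $V(G)$ such that: (progress) $\mathcal M_{G,\lambda,v}(W,W')>0$ implies $W\subseteq W'$; (termination) $\mathcal M_{G,\lambda,v}(W,W)=1$ iff $W$ contains a mend of $\lambda$ at $v$; (locality) $\mathcal M_{G,\lambda,v}(W,\cdot)$ depends only on $W$ and its direct neighborhood. In the exploration model only neighbors of already explored vertices can be newly explored, so states reached from $\{v\}$ are connected. The chain is absorbing; $\mathcal M^*_{G,\lambda,v}(\{v\},\cdot)$ is its limiting distribution started at $\{v\}$, and $\mathcal F=\mathcal F^{\mathcal M}_{G,\lambda,v}(\{v\})$ is the set of absorbing (final) states reachable from $\{v\}$. Then $\mathsf{EMVol}(\mathcal M,G)=\max_{\lambda,v}\sum_{W_F}\mathcal M^*_{G,\lambda,v}(\{v\},W_F)|W_F|$, $\mathsf{DMVol}(\mathcal M,G)=\max_{\lambda,v}\max_{W_F\in\mathcal F}|W_F|$, $\mathsf{MRad}(\mathcal M,G)=\max_{\lambda,v}\min_{W_F\in\mathcal F}\max_{w\in W_F}\mathrm{dist}(v,w)$. For each such measure $X$: $\Pi$ has $X=O(T)$ if there is a mender $\mathcal M$ with $X(\mathcal M,G_n)=O(T(n))$ on all instances $G_n\in\mathcal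 G$ of size $n$; $\Pi$ has $X=\Omega(T)$ if for every mender $\mathcal M$ there are instances $G_n$ of size $n$ with $X(\mathcal M,G_n)=\Omega(T(n))$; $\Theta$ means both. $|N_{\mathsf{MRad}}|$ is the maximum number of vertices in a neighborhood of radius $\mathsf{MRad}$ (of the optimal mender) in an instance of size $n$. Known fact from earlier work, which may be used: on paths and cycles, the mending radius $\mathsf{MRad}$ of every LCL problem is either $O(1)$ or $\Theta(n)$. *)

(* Defs.v *)
From HB Require Import structures.
From mathcomp Require Import all_boot all_order all_fingroup all_algebra.
From mathcomp Require Import all_classical all_reals all_analysis.

Set Implicit Arguments.
Unset Strict Implicit.
Unset Printing Implicit Defensive.

Import Order.TTheory GRing.Theory Num.Theory numFieldNormedType.Exports.

Local Open Scope classical_set_scope.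
Local Open Scope ring_scope.

(* Finite simple graphs with vertex set 'I_n, given by their sets of edges. *)

Record graph (n : nat) := Graph {
  edges : {set {set 'I_n}};
  _ : [forall e in edges, #|e| == 2%N] }.
HB.instance Definition _ n := [isSub for @edges n].
HB.instance Definition _ n := [Equality of graph n by <:].
HB.instance Definition _ n := [Choice of graph n by <:].
HB.instance Definition _ n := [Countable of graph n by <:].
HB.instance Definition _ n := [Finite of graph n by <:].

Definition adj n (G : graph n) (x y : 'I_n) : bool := [set x; y]%SET \in edges G.

Definition cnbhd n (G : graph n) (W : {set 'I_n}) : {set 'I_n} :=
  W :|: [set y | [exists x in W, adj G x y]].

(* the vertices at distance at most k from W *)
Definition ball n (G : graph n) (k : nat) (W : {set 'I_n}) : {set 'I_n} :=
  iter k (cnbhd G) W.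

(* Equals n when x and y are in different connected components; it is only
   used below for vertices of the same component. *)
Definition dist n (G : graph n) (x y : 'I_n) : nat :=
  \big[minn/n]_(k < n | y \in ball G k [set x]%SET) k.

Definition graph_iso n (G G' : graph n) : Prop :=
  exists s : {perm 'I_n}, forall x y, adj G' (s x) (s y) = adj G x y.

(* f is an isomorphism from the labeled subgraph of G induced by A
   onto the labeled subgraph of G' induced by A'. *)
Record labeled_iso (L : Type) n m (G : graph n) (G' : graph m)
    (l : 'I_n -> L) (l' : 'I_m -> L) (A : {set 'I_n}) (A' : {set 'I_m})
    (f : 'I_n -> 'I_m) : Prop := LabeledIso {
  labeled_iso_inj : {in A &, injective f};
  labeled_iso_im : (f @: A)%SET = A';
  labeled_iso_adj : {in A &, forall x y, adj G' (f x) (f y) = adj G x y};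
  labeled_iso_label : {in A, forall x, l' (f x) = l x} }.

(* None is the symbol for a hole *)
Definition labeling (S : finType) (n : nat) := {ffun 'I_n -> option S}.

Record lcl := LCL {
  label : finType;
  in_class : forall n, pred (graph n);
  vradius : nat;
  happy : forall n, graph n -> labeling label n -> 'I_n -> bool;
  in_class_iso : forall n (G G' : graph n), graph_iso G G' -> in_class G -> in_class G';
  happy_local : forall n m (G : graph n) (G' : graph m)
        (l : labeling label n) (l' : labeling label m) v v' f,
      in_class G -> in_class G' ->
      labeled_iso G G' l l' (ball G vradius [set v]%SET)
        (ball G' vradius [set v']%SET) f ->
      f v = v' -> happy G l v = happy G' l' v' }.

Section Mending.
Variable P : lcl.

Definition bounded_degree : Prop :=
  exists D : nat, forall n (G : graph n) (x : 'I_n),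
    in_class P G -> (#|[set y | adj G x y]%SET| <= D)%N.

Definition partial_solution n (G : graph n) (l : labeling (label P) n) : bool :=
  [forall v, [forall u in ball G (vradius P) [set v]%SET, l u != None]
             ==> happy G l v].

Definition hole n (l : labeling (label P) n) (v : 'I_n) : bool := l v == None.

Definition mend n (G : graph n) (l : labeling (label P) n) (v : 'I_n)
    (l' : labeling (label P) n) : bool :=
  [&& partial_solution G l', l' v != None
    & [forall u, (l u != None) ==> (l' u != None)]].

Definition instance n (G : graph n) (l : labeling (label P) n) (v : 'I_n) :=
  [&& in_class P G, partial_solution G l & hole l v].

Definition mends_exist : Prop :=
  forall n (G : graph n) (l : labeling (label P) n) (v : 'I_n),
    instance G l v -> exists l', mend G l v l'.

Definition changes n (l l' : labeling (label P) n) : {set 'I_n} :=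
  [set u | l u != l' u].

Definition contains_mend n (G : graph n) (l : labeling (label P) n) (v : 'I_n)
    (W : {set 'I_n}) : bool :=
  [exists l', mend G l v l' && (changes l l' \subset W)].

(* The default value n of the minimum is harmless: no mend changes more than
   n vertices. *)
Definition ExMVol n (G : graph n) : nat :=
  \max_(l : labeling (label P) n | partial_solution G l)
  \max_(v | hole l v)
  \big[minn/n]_(l' | mend G l v l') #|changes l l'|.

End Mending.

Section Menders.
Variables (R : realType) (rho : nat -> nat) (P : lcl).

(* M n G l v W W' is the probability of the transition from W to W' *)
Definition chains : Type :=
  forall n, graph n -> labeling (label P) n -> 'I_n ->
  {set 'I_n} -> {set 'I_n} -> R.

(* The states of the chain of (G, l, v) are the sets of vertices containing v
   (all sets reached from {v} do); the rows of the other sets are irrelevant.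

   Locality: the transitions from W depend only on v, W and the labeled
   subgraph induced by the vertices within distance rho r of W, where r is the
   radius of the verifier; vertices keep their names. The literal reading of
   the direct neighborhood of W is rho r = 1. However, whether W contains a
   mend depends on what happens up to distance 2r of W (a change in W affects
   the verifier up to distance r, which looks r further), so with rho r = 1
   the termination condition contradicts locality for many problems, and these
   have no mender at all; rho r >= 2r always suffices. Hence rho is kept as a
   parameter. *)
Record is_mender (M : chains) : Prop := IsMender {
  mender_ge0 : forall n (G : graph n) l v (W W' : {set 'I_n}),
    instance G l v -> v \in W -> 0 <= M n G l v W W';
  mender_sum1 : forall n (G : graph n) l v (W : {set 'I_n}),
    instance G l v -> v \in W -> \sum_W' M n G l v W W' = 1;
  mender_progress : forall n (G : graph n) l v (W W' : {set 'I_n}),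
    instance G l v -> v \in W -> 0 < M n G l v W W' -> W \subset W';
  mender_exploration : forall n (G : graph n) l v (W W' : {set 'I_n}),
    instance G l v -> v \in W -> 0 < M n G l v W W' -> W' \subset cnbhd G W;
  mender_termination : forall n (G : graph n) l v (W : {set 'I_n}),
    instance G l v -> v \in W ->
    M n G l v W W = 1 <-> contains_mend G l v W;
  mender_locality : forall n m (G : graph n) (G' : graph m) l l' v v'
      (W : {set 'I_n}) (W' : {set 'I_m}) (f : 'I_n -> 'I_m),
    instance G l v -> instance G' l' v' -> v \in W -> v' \in W' ->
    labeled_iso G G' l l' (ball G (rho (vradius P)) W)
      (ball G' (rho (vradius P)) W') f ->
    {in ball G (rho (vradius P)) W, forall x, f x = x :> nat} ->
    f v = v' -> (f @: W)%SET = W' ->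
    forall X : {set 'I_n}, X \subset ball G (rho (vradius P)) W ->
    M n G l v W X = M m G' l' v' W' (f @: X)%SET }.

Section Measures.
Variables (M : chains) (n : nat) (G : graph n).

Fixpoint steps (l : labeling (label P) n) (v : 'I_n) (k : nat)
    (W W' : {set 'I_n}) : R :=
  if k is k'.+1 then \sum_U M G l v W U * steps l v k' U W' else (W == W')%:R.

Definition limit_distribution l v (W : {set 'I_n}) : R :=
  limn (fun k => steps l v k [set v]%SET W).

Definition final l v (W : {set 'I_n}) : bool :=
  `[< exists k, 0 < steps l v k [set v]%SET W >] && (M G l v W W == 1).

Definition EMVol : R :=
  \big[Num.max/0]_(l : labeling (label P) n | partial_solution G l)
  \big[Num.max/0]_(v | hole l v)
  \sum_(W | final l v W) limit_distribution l v W * #|W|%:R.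

Definition DMVol : nat :=
  \max_(l : labeling (label P) n | partial_solution G l)
  \max_(v | hole l v)
  \max_(W | final l v W) #|W|.

(* As above, the default value n of the minimum is harmless: distances in a
   component are smaller than n. *)
Definition MRad : nat :=
  \max_(l : labeling (label P) n | partial_solution G l)
  \max_(v | hole l v)
  \big[minn/n]_(W | final l v W) \max_(w in W) dist G v w.

End Measures.

Definition MRad_size (M : chains) (n : nat) : nat :=
  \max_(G : graph n | in_class P G) MRad M G.

Definition optimal_mender (M : chains) : Prop :=
  is_mender M /\
  forall M', is_mender M' -> forall n, (MRad_size M n <= MRad_size M' n)%N.

Definition NMRad (M : chains) (n : nat) : nat :=
  \max_(G : graph n | in_class P G) \max_(u : 'I_n)
    #|ball G (MRad_size M n) [set u]%SET|.

End Menders.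

Inductive measure_name := mMRad | mExMVol | mEMVol | mDMVol | mNMRad.

Section Asymptotics.
Variables (R : realType) (rho : nat -> nat) (P : lcl).

Definition worst (X : forall n, graph n -> R) (n : nat) : R :=
  \big[Num.max/0]_(G : graph n | in_class P G) X n G.

(* The worst-case costs, as functions of the size of the instance, that the
   menders of P achieve for a given measure. Menders play no role in the
   existential mending volume, which thus gives a single function. *)
Definition costs (X : measure_name) : set (nat -> R) :=
  match X with
  | mMRad => [set worst (fun n G => (MRad M G)%:R) | M in @is_mender R rho P]
  | mExMVol => [set worst (fun n G => (ExMVol P G)%:R)]
  | mEMVol => [set worst (fun n G => EMVol M G) | M in @is_mender R rho P]
  | mDMVol => [set worst (fun n G => (DMVol M G)%:R) | M in @is_mender R rho P]
  | mNMRad =>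
      [set (fun n => (NMRad M n)%:R) | M in @optimal_mender R rho P]
  end.

(* "for all large enough n such that there are instances of size n" *)
Definition large_sizes : set_system nat :=
  within [set n | exists G : graph n, in_class P G] \oo.

Definition is_O (X : measure_name) (T : nat -> R) : Prop :=
  exists2 f, costs X f &
    exists C : R, \forall n \near large_sizes, f n <= C * T n.

Definition is_Omega (X : measure_name) (T : nat -> R) : Prop :=
  forall f, costs X f ->
    exists2 c : R, 0 < c & \forall n \near large_sizes, c * T n <= f n.

Definition is_Theta (X : measure_name) (T : nat -> R) : Prop :=
  is_O X T /\ is_Omega X T.

(* Equality of the orders of growth. Radii may be 0 where volumes are 1, so
   bounds that are not bounded away from 0 and constant lower bounds are left
   out. *)
Definition asymptotically_equivalent (X Y : measure_name) : Prop :=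
  (forall T : nat -> R, (forall n, 1 <= T n) -> is_O X T <-> is_O Y T) /\
  (forall T : nat -> R, T @ \oo --> +oo -> is_Omega X T <-> is_Omega Y T).

End Asymptotics.

Definition is_path n (G : graph n) : Prop :=
  (0 < n)%N /\ exists s : {perm 'I_n}, forall x y : 'I_n,
    adj G (s x) (s y) = ((y == x.+1 :> nat) || (x == y.+1 :> nat))%N.

Definition is_cycle n (G : graph n) : Prop :=
  (2 < n)%N /\ exists s : {perm 'I_n}, forall x y : 'I_n,
    adj G (s x) (s y) = ((y == x.+1 %% n :> nat) || (x == y.+1 %% n :> nat))%N.

Definition on_paths_and_cycles (P : lcl) : Prop :=
  forall n (G : graph n), in_class P G -> is_path G \/ is_cycle G.

(* The known dichotomy for the mending radius on paths and cycles
   (Balliu, Hirvonen, Melnyk, Olivetti, Rybicki, Suomela: Local Mending);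
   it presupposes that menders exist, as is the case if rho r >= 2r. *)
Definition MRad_dichotomy (R : realType) (rho : nat -> nat) : Prop :=
  forall P : lcl, mends_exist P -> on_paths_and_cycles P ->
    is_O rho P mMRad (fun=> 1 : R) \/ is_Theta rho P mMRad (fun n => n%:R : R).

(* Main.v *)
Require Import Defs.
From mathcomp Require Import all_boot all_order all_fingroup all_algebra.
From mathcomp Require Import all_classical all_reals all_analysis.

Set Implicit Arguments.
Unset Strict Implicit.
Unset Printing Implicit Defensive.

Import Order.TTheory GRing.Theory Num.Theory numFieldNormedType.Exports.
(* The analysis library has a [ball] of its own. *)
Import Defs.

Local Open Scope ring_scope.

(** Since some mender exists, whether a set contains a mend depends only on its
    surroundings, so growing balls around the hole until they contain a mend is
    itself a mender; it has the least possible [MRad]. A smallest mend changes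
    only vertices within distance [2r] times its size, because the changes in
    the [2r]-component of the hole already form a mend. Hence the radius of the
    ball mender is [O(ExMVol)], and [ExMVol] is below [EMVol] and [DMVol] of
    every mender, as the chains are absorbed with probability 1 by sets that
    contain a mend. Conversely, the degrees being bounded, the volumes of the
    ball mender are at most exponential in its radius. *)

(** * Minima with a default value, and stabilizing iterations *)

Lemma bigminn_le (I : finType) (N : nat) (Q : pred I) (F : I -> nat) (i : I) :
  Q i -> (\big[minn/N]_(j | Q j) F j <= F i)%N.
Proof. by move=> Qi; rewrite -minEnat -leEnat; exact: bigmin_le_cond. Qed.

Lemma bigminn_le_default (I : finType) (N : nat) (Q : pred I) (F : I -> nat) :
  (\big[minn/N]_(j | Q j) F j <= N)%N.
Proof. by elim/big_rec: _ => // i x _; exact/leq_trans/geq_minr. Qed.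

Lemma leq_bigminn (I : finType) (N m : nat) (Q : pred I) (F : I -> nat) :
  (m <= N)%N -> (forall i, Q i -> m <= F i)%N ->
  (m <= \big[minn/N]_(j | Q j) F j)%N.
Proof.
by move=> mN mF; elim/big_ind: _ => // x y mx my; rewrite leq_min mx my.
Qed.

(** Each step that is not yet stationary adds an element, so without a fixed point the iterate of
    index [#|D|.+1] would have more elements than [D]. *)
Lemma iter_fixpoint (T : finType) (f : {set T} -> {set T}) (A D : {set T}) :
  (forall B : {set T}, B \subset f B) -> (forall k, iter k f A \subset D) ->
  exists2 k, (k <= #|D|)%N & f (iter k f A) = iter k f A.
Proof.
move=> f_ext fD; case: (pselect (exists2 k, (k <= #|D|)%N &
  f (iter k f A) = iter k f A)) => // no_fix.
have grow k : (k <= #|D|.+1)%N -> (k <= #|iter k f A|)%N.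
  elim: k => // k IH kD; apply: leq_ltn_trans (IH (ltnW kD)) _.
  apply: proper_card; rewrite finset.properEneq f_ext andbT.
  by apply/eqP => fk; apply: no_fix; exists k.
by have := leq_trans (grow _ (leqnn _)) (subset_leq_card (fD _)); rewrite ltnn.
Qed.

(** * Balls and distances *)

Section Balls.
Variables (n : nat) (G : graph n).
Implicit Types (x y v w : 'I_n) (A B W : {set 'I_n}) (j k : nat).

Lemma sub_cnbhd W : W \subset cnbhd G W.
Proof. exact: finset.subsetUl. Qed.

Lemma adjC x y : adj G x y = adj G y x.
Proof. by rewrite /adj finset.setUC. Qed.

Lemma mem_cnbhd W y :
  reflect (y \in W \/ exists2 x, x \in W & adj G x y) (y \in cnbhd G W).
Proof.
rewrite /cnbhd !inE; apply: (iffP orP).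
  by case=> [|/existsP[x /andP[]]]; [left | right; exists x].
by case=> [|[x xW xy]]; [left | right; apply/existsP; exists x; rewrite xW].
Qed.

Lemma cnbhdS A B : A \subset B -> cnbhd G A \subset cnbhd G B.
Proof.
move=> AB; apply/fintype.subsetP => y.
move=> /mem_cnbhd[/(fintype.subsetP AB) yB|[x xA xy]];
  apply/mem_cnbhd; first by left.
by right; exists x => //; exact: (fintype.subsetP AB).
Qed.

Lemma ballS k A B : A \subset B -> ball G k A \subset ball G k B.
Proof. by move=> AB; elim: k => //= k; exact: cnbhdS. Qed.

Lemma ballD j k W : ball G (j + k) W = ball G j (ball G k W).
Proof. exact: iterD. Qed.

Lemma sub_ball k W : W \subset ball G k W.
Proof. by elim: k => //= k /fintype.subset_trans; apply; exact: sub_cnbhd. Qed.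

Lemma leq_ball j k W : (j <= k)%N -> ball G j W \subset ball G k W.
Proof. by move=> /subnK <-; rewrite ballD; exact: sub_ball. Qed.

Lemma ball_sym k x y :
  (y \in ball G k [set x]%SET) = (x \in ball G k [set y]%SET).
Proof.
suff sym u v : v \in ball G k [set u]%SET -> u \in ball G k [set v]%SET.
  by apply/idP/idP; exact: sym.
elim: k u v => [|k IH] u v; first by rewrite !inE eq_sym.
rewrite [ball _ _ _]/= => /mem_cnbhd[/IH|[w /IH uw wv]].
  exact/fintype.subsetP/leq_ball.
rewrite /ball iterSr; apply: (fintype.subsetP (ballS k _)) uw.
apply/fintype.subsetP => z /set1P ->; apply/mem_cnbhd; right.
by exists v; rewrite ?set11 // adjC.
Qed.

Lemma ball_stable k j W :
  ball G k.+1 W = ball G k W -> (k <= j)%N -> ball G j W = ball G k W.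
Proof. by move=> kW /subnK <-; elim: (j - k)%N => //= i ->. Qed.

(** A ball that fails to grow in one step never grows again. Since [y] is reached at some radius but
    at none below [k], each of the first [k] steps adds a vertex to the singleton. *)
Lemma ltn_card_ball x y k j : y \in ball G j [set x]%SET ->
  (forall i, (i < k)%N -> y \notin ball G i [set x]%SET) ->
  (k < #|ball G k [set x]%SET|)%N.
Proof.
move=> yj; elim: k => [|k IH] yk; first by rewrite cards1.
apply: (leq_ltn_trans (IH _)) => [i ik|]; first exact/yk/ltnW.
apply: proper_card; rewrite finset.properEneq leq_ball // andbT eq_sym.
apply: contraNneq (yk k (leqnn _)) => kE.
have [jk|/ltnW kj] := leqP j k; first exact: (fintype.subsetP (leq_ball _ jk)).
by rewrite -(ball_stable kE kj).
Qed.

Lemma dist_le x y : (dist G x y <= n)%N.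
Proof. exact: bigminn_le_default. Qed.

Lemma dist_leq k x y : y \in ball G k [set x]%SET -> (dist G x y <= k)%N.
Proof.
move=> yk; have [nk|kn] := leqP n k; first exact: leq_trans (dist_le _ _) nk.
exact: (@bigminn_le _ n _ (fun i : 'I_n => nat_of_ord i) (Ordinal kn)).
Qed.

Lemma notin_ball_dist k x y :
  (k < dist G x y)%N -> y \notin ball G k [set x]%SET.
Proof. by rewrite ltnNge; apply: contra; exact: dist_leq. Qed.

Lemma mem_ball_dist k x y :
  y \in ball G k [set x]%SET -> y \in ball G (dist G x y) [set x]%SET.
Proof.
move=> yk.
have ex_k : exists k, y \in ball G k [set x]%SET by exists k.
have [j yj j_min] := ex_minnP ex_k.
suff /eqP -> : dist G x y == j by [].
rewrite eqn_leq dist_leq //=; apply: leq_bigminn => [|i /j_min//].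
(* The default value [n] of [dist] does not interfere: [ltn_card_ball] makes [j] smaller than the
   size of a ball, which is at most [n]. *)
have := max_card (mem (ball G j [set x]%SET)); rewrite card_ord.
apply: leq_trans.
apply/ltnW/(ltn_card_ball yj) => i; rewrite ltnNge; apply: contra; exact: j_min.
Qed.

Lemma card_cnbhd D W :
  (forall x, (#|[set y | adj G x y]%SET| <= D)%N) ->
  (#|cnbhd G W| <= D.+1 * #|W|)%N.
Proof.
move=> degD; rewrite mulSn; apply: leq_trans (leq_card_setU _ _) _.
rewrite leq_add2l.
have -> : [set y | [exists x in W, adj G x y]]%SET =
  (\bigcup_(x in W) [set y | adj G x y])%SET.
  apply/setP => y; rewrite inE; apply/'exists_andP/bigcupP => -[x].
    by move=> [xW xy]; exists x; rewrite ?inE.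
  by move=> xW; rewrite inE => xy; exists x.
rewrite mulnC -sum_nat_const.
elim/big_rec2: _ => [|x m B _ le_Bm]; first by rewrite cards0.
by apply: leq_trans (leq_card_setU _ _) _; rewrite leq_add.
Qed.

Lemma card_ball D k x : (forall y, (#|[set z | adj G y z]%SET| <= D)%N) ->
  (#|ball G k [set x]%SET| <= D.+1 ^ k)%N.
Proof.
move=> degD; elim: k => [|k IH]; first by rewrite cards1.
by apply: leq_trans (card_cnbhd _ degD) _; rewrite expnS leq_mul2l IH.
Qed.

End Balls.

(** * Confining a mend to a ball around the hole *)

Section Mends.
Variables (P : lcl) (n : nat) (G : graph n).
Implicit Types (l : labeling (label P) n) (v : 'I_n) (W : {set 'I_n}).

Lemma contains_mendS l v (W W' : {set 'I_n}) :
  W \subset W' -> contains_mend G l v W -> contains_mend G l v W'.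
Proof.
move=> WW' /existsP[l' /andP[mend_l' subW]]; apply/existsP; exists l'.
by rewrite mend_l' (fintype.subset_trans subW WW').
Qed.

Lemma happy_eq l l' v : in_class P G ->
  {in ball G (vradius P) [set v]%SET, l =1 l'} -> happy G l v = happy G l' v.
Proof.
move=> G_P l_l'; apply: (@happy_local P n n G G l l' v v id) => //.
by split=> // [|x xv]; [rewrite imset_id | rewrite l_l'].
Qed.

(* Of the changed vertices, only those in the component of v with respect to
   steps of length at most 2r have to be changed: no verifier sees two
   components at once. *)
Lemma contains_mend_ball l v l' : instance G l v -> mend G l v l' ->
  contains_mend G l v
    (ball G (2 * vradius P * #|changes l l'|) [set v]%SET).
Proof.
set r := vradius P => /and3P[G_P sol_l hole_v] /and3P[sol_l' l'v l_l'].
(* Iterating [f] from [v] adds, round by round, the changed vertices within distance [2r]. The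
   iterates stay inside [ch], so they stabilize within [#|ch|] rounds, each of which costs at most
   [2r] in the radius. *)
pose ch := changes l l'; pose f W := (W :|: ch :&: ball G (2 * r) W)%SET.
have f_ext (B : {set 'I_n}) : B \subset f B by exact: finset.subsetUl.
have v_ch : v \in ch.
  by rewrite inE; move: hole_v => /eqP ->; rewrite eq_sym.
have f_ch k : iter k f [set v]%SET \subset ch.
  elim: k => [|k IH]; first by rewrite finset.sub1set.
  by rewrite iterS finset.subUset IH finset.subsetIl.
have [k k_ch fix_k] := iter_fixpoint f_ext f_ch.
set C := iter k f [set v]%SET in fix_k.
have iter_ball i : iter i f [set v]%SET \subset ball G (2 * r * i) [set v]%SET.
  elim: i => [|i IH]; first by rewrite muln0.
  rewrite iterS mulnS ballD finset.subUset; apply/andP; split.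
    exact: fintype.subset_trans IH (sub_ball _ _ _).
  by apply: fintype.subset_trans (finset.subsetIr _ _) (ballS _ _ IH).
have C_ball : C \subset ball G (2 * r * #|ch|) [set v]%SET.
  apply: fintype.subset_trans (iter_ball k) (leq_ball _ _ _).
  by rewrite leq_mul2l k_ch orbT.
have v_iter i : v \in iter i f [set v]%SET.
  by elim: i => [|i IH]; [exact: set11 | exact: (fintype.subsetP (f_ext _))].
have vC : v \in C by exact: v_iter.
have C_closed y : y \in ch -> y \in ball G (2 * r) C -> y \in C.
  by move=> y_ch yC; rewrite -fix_k finset.in_setU finset.in_setI y_ch yC orbT.
pose l'' : labeling (label P) n := [ffun u => if u \in C then l' u else l u].
have l''E u : l'' u = if u \in C then l' u else l u by rewrite ffunE.
apply/existsP; exists l''; apply/andP; split; last first.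
  apply: fintype.subset_trans C_ball; apply/fintype.subsetP => u.
  by rewrite inE l''E; case: ifP; rewrite ?eqxx.
apply/and3P; split; last first.
- apply/forallP => u; apply/implyP => lu; rewrite l''E; case: ifP => // _.
  by move/forallP: l_l' => /(_ u); rewrite lu.
- by rewrite l''E vC.
apply/forallP => u; apply/implyP => /forallP no_hole.
(* If the verifier at [u] sees a vertex [c] of [C], all that it sees is within [2r] of [c], so the
   changed vertices among these are in [C] and [u] sees exactly [l']. Otherwise it sees exactly
   [l]. *)
have [/existsP[c /andP[cC cu]]|] :=
    boolP [exists c, (c \in C) && (c \in ball G r [set u]%SET)].
  have l''_l' : {in ball G r [set u]%SET, l'' =1 l'}.
    move=> y yu; rewrite l''E; case: ifPn => // yC; apply/eqP.
    apply: contraNT yC => ly; apply: C_closed; first by rewrite inE.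
    have yc : y \in ball G (2 * r) [set c]%SET.
      rewrite mul2n -addnn ballD. apply: (fintype.subsetP (ballS G r _)) yu.
      by rewrite finset.sub1set ball_sym.
    by apply: (fintype.subsetP (ballS G (2 * r) _)) yc; rewrite finset.sub1set.
  rewrite (happy_eq G_P l''_l'); move/forallP: sol_l' => /(_ u)/implyP; apply.
  apply/forallP => y; apply/implyP => yu; rewrite -l''_l' //.
  by move: (no_hole y); rewrite yu.
rewrite negb_exists => /forallP disj.
have l''_l : {in ball G r [set u]%SET, l'' =1 l}.
  move=> y yu; rewrite l''E; case: ifPn => // yC.
  by move: (disj y); rewrite yC yu.
rewrite (happy_eq G_P l''_l); move/forallP: sol_l => /(_ u)/implyP; apply.
apply/forallP => y; apply/implyP => yu; rewrite -l''_l //.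
by move: (no_hole y); rewrite yu.
Qed.

End Mends.

(** * Absorption of the chain of a mender *)

Section Absorption.
Variables (R : realType) (rho : nat -> nat) (P : lcl) (M : chains R P).
Hypothesis menderM : is_mender rho M.
Variables (n : nat) (G : graph n) (l : labeling (label P) n) (v : 'I_n).
Hypothesis inst : instance G l v.
Implicit Types (W U A : {set 'I_n}) (k : nat).

Local Notation p := (M G l v).
Local Notation st := (steps M G l v).

Lemma transition_ge0 W U : v \in W -> 0 <= p W U.
Proof. exact: (mender_ge0 menderM). Qed.

Lemma transition_sum1 W : v \in W -> \sum_U p W U = 1.
Proof. exact: (mender_sum1 menderM). Qed.

Lemma transition_eq0 W U : v \in W ->
  ~~ ((W \subset U) && (U \subset cnbhd G W)) -> p W U = 0.
Proof.
move=> vW; apply: contraNeq => pWU.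
have pWU_gt0 : 0 < p W U by rewrite lt_def pWU transition_ge0.
by rewrite (mender_progress menderM inst vW pWU_gt0)
  (mender_exploration menderM inst vW pWU_gt0).
Qed.

Lemma absorbing_transition W U : v \in W -> p W W = 1 -> p W U = (W == U)%:R.
Proof.
move=> vW pW1; have [<-|WU] := eqVneq W U; first by rewrite pW1.
rewrite mulr0n; apply/eqP; rewrite eq_le transition_ge0 // andbT.
have := transition_sum1 vW; rewrite (bigD1 W) //= pW1 => /(canRL (addKr _)).
rewrite addNr => sum0; rewrite -sum0 (bigD1 U) 1?eq_sym //= lerDl.
by apply: sumr_ge0 => X _; exact: transition_ge0.
Qed.

(** Progress and exploration leave a closed set no transition except to itself, so it is absorbing
    and termination applies. Hence a set without a mend always has room to grow. *)
Lemma closed_contains_mend W :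
  v \in W -> cnbhd G W = W -> contains_mend G l v W.
Proof.
move=> vW closedW; apply/(mender_termination menderM inst vW).
rewrite -[RHS](transition_sum1 vW) (bigD1 W) //= big1 ?addr0 // => U UW.
by apply: transition_eq0 vW _; rewrite closedW -finset.eqEsubset eq_sym.
Qed.

(* A transition to a state without v has probability 0, so that properties of
   the states that contain v propagate along the chain. *)
Lemma transitionM_le W (F F' : {set 'I_n} -> R) : v \in W ->
  (forall U, W \subset U -> F U <= F' U) ->
  \sum_U p W U * F U <= \sum_U p W U * F' U.
Proof.
move=> vW FF'; apply: ler_sum => U _.
have [/andP[WU _]|/(transition_eq0 vW) ->] :=
  boolP ((W \subset U) && (U \subset cnbhd G W)); last by rewrite !mul0r.
by rewrite ler_wpM2l ?transition_ge0 ?FF'.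
Qed.

Lemma steps_ge0 k W A : v \in W -> 0 <= st k W A.
Proof.
elim: k W => [|k IH] W vW /=; first exact: ler0n.
apply: sumr_ge0 => U _.
have [/andP[/fintype.subsetP WU _]|/(transition_eq0 vW) ->] :=
  boolP ((W \subset U) && (U \subset cnbhd G W)); last by rewrite mul0r.
by rewrite mulr_ge0 ?transition_ge0 ?IH //; exact: WU.
Qed.

Lemma steps_sum1 k W : v \in W -> \sum_A st k W A = 1.
Proof.
elim: k W => [|k IH] W vW /=.
  rewrite (bigD1 W) //= eqxx big1 ?addr0 // => A.
  by rewrite eq_sym => /negPf ->.
rewrite exchange_big -[RHS](transition_sum1 vW) /=; apply: eq_bigr => U _.
rewrite -mulr_sumr.
have [/andP[/fintype.subsetP WU _]|/(transition_eq0 vW) ->] :=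
  boolP ((W \subset U) && (U \subset cnbhd G W)); last by rewrite !mul0r.
by rewrite IH ?mulr1 //; exact: WU.
Qed.

Lemma steps_sub k W A : v \in W -> 0 < st k W A ->
  (W \subset A) && (A \subset ball G k W).
Proof.
elim: k W => [|k IH] W vW.
  by rewrite /= ltr0n lt0b => /eqP <-; rewrite fintype.subxx.
apply: contraTT => notWA; rewrite -leNgt /= big1 // => U _.
have [/andP[WU UW]|/(transition_eq0 vW) ->] :=
  boolP ((W \subset U) && (U \subset cnbhd G W)); last by rewrite mul0r.
have vU : v \in U by exact: (fintype.subsetP WU).
suff -> : st k U A = 0 by rewrite mulr0.
apply/eqP; rewrite eq_le steps_ge0 // andbT leNgt.
apply: contra notWA => /(IH _ vU)/andP[UA AU].
rewrite (fintype.subset_trans WU UA) (fintype.subset_trans AU) //.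
by rewrite /ball iterSr ballS.
Qed.

(** Mass that has arrived in an absorbing state stays there; this monotonicity makes the limiting
    distribution exist. *)
Lemma steps_absorbing_le k W A : v \in W -> v \in A -> p A A = 1 ->
  st k W A <= st k.+1 W A.
Proof.
move=> vW vA pA1; elim: k W vW => [|k IH] W vW; last first.
  rewrite [leLHS]/= [leRHS]/=; apply: transitionM_le => // U.
  by move=> /fintype.subsetP WU; apply: IH; exact: WU.
rewrite [leLHS]/=; have [->|_] := eqVneq W A; last exact: steps_ge0.
rewrite /= (bigD1 A) //= eqxx mulr1 pA1 lerDl.
by apply: sumr_ge0 => X _; rewrite mulr_ge0 ?transition_ge0.
Qed.

(** Survival probability: absorption with probability 1 means that it tends to 0. *)
Definition transient k W : R := \sum_(A | p A A != 1) st k W A.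

Lemma transientS k W : transient k.+1 W = \sum_U p W U * transient k U.
Proof.
rewrite /transient /= exchange_big /=; apply: eq_bigr => U _.
by rewrite mulr_sumr.
Qed.

Lemma transient_ge0 k W : v \in W -> 0 <= transient k W.
Proof. by move=> vW; apply: sumr_ge0 => A _; exact: steps_ge0. Qed.

Lemma transient0 W : transient 0 W = (p W W != 1)%:R.
Proof.
rewrite /transient /=; have [pW1|pW1] := eqVneq (p W W) 1.
  by rewrite big1 // => A; have [<-|] := eqVneq W A; rewrite ?pW1 ?eqxx.
rewrite (bigD1 W) //= eqxx big1 ?addr0 // => A /andP[_].
by rewrite eq_sym => /negPf ->.
Qed.

Lemma transient_absorbing k W : v \in W -> p W W = 1 -> transient k W = 0.
Proof.
move=> vW pW1; elim: k => [|k IH]; first by rewrite transient0 pW1 eqxx.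
rewrite transientS big1 // => U _; rewrite absorbing_transition //.
by have [<-|] := eqVneq W U; rewrite ?IH ?mul0r ?mulr0.
Qed.

Lemma transient_noninc k W : v \in W -> transient k.+1 W <= transient k W.
Proof.
elim: k W => [|k IH] W vW; last first.
  rewrite transientS [leRHS]transientS; apply: transitionM_le => // U.
  by move=> /fintype.subsetP WU; apply: IH; exact: WU.
have [pW1|pW1] := eqVneq (p W W) 1; first by rewrite !transient_absorbing.
rewrite transientS transient0 pW1 -(transition_sum1 vW).
apply: ler_sum => U _; rewrite ler_piMr ?transition_ge0 //.
by rewrite transient0 lern1 leq_b1.
Qed.

(* The chain leaves a non-absorbing state W for larger sets only, so by
   induction the limit L of [transient k W] satisfies L = p W W * L. *)
Lemma transient_cvg0 W : v \in W -> (transient k W @[k --> \oo] --> 0)%classic.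
Proof.
have [m] := ubnP #|~: W|%SET; elim: m W => // m IH W Wm vW.
have [pW1|pW1] := eqVneq (p W W) 1.
  rewrite (_ : (fun k => _) = cst 0); first exact: cvg_cst.
  by apply/funext => k; exact: transient_absorbing.
have is_cvgW : cvgn (transient ^~ W).
  apply: nonincreasing_is_cvgn.
    by apply/nonincreasing_seqP => k; exact: transient_noninc.
  by exists 0 => _ [k _ <-]; exact: transient_ge0.
set L := limn (transient ^~ W).
have cvgL : (transient k W @[k --> \oo] --> L)%classic by exact: is_cvgW.
suff L0 : L = 0 by move: cvgL; rewrite L0.
have cvg_other : (\sum_(U | U != W) p W U * transient k U @[k --> \oo]
    --> \sum_(U : {set 'I_n} | U != W) (0 : R))%classic.
  apply: cvg_big => [|U UW]; first exact: add_continuous.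
  have [/andP[WU UcW]|/(transition_eq0 vW) ->] :=
      boolP ((W \subset U) && (U \subset cnbhd G W)); last first.
    by under eq_fun do rewrite mul0r; exact: cvg_cst.
  suff: (p W U * transient k U @[k --> \oo] --> p W U * 0)%classic.
    by rewrite mulr0.
  apply: cvgMl_tmp; apply: IH.
    rewrite -ltnS; apply: leq_trans Wm; rewrite ltnS; apply: proper_card.
    by rewrite properC finset.properEneq eq_sym UW.
  exact: (fintype.subsetP WU).
have cvg_shift : (transient k.+1 W @[k --> \oo] --> p W W * L + 0)%classic.
  under eq_fun do rewrite transientS (bigD1 W) //=.
  apply: cvgD; first exact: cvgMl_tmp.
  by move: cvg_other; rewrite big1.
have cvg_shift' : (transient k.+1 W @[k --> \oo] --> L)%classic.
  by move: cvgL; rewrite -(cvg_shiftS (transient ^~ W)).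
have : (1 - p W W) * L = 0.
  rewrite mulrBl mul1r; apply/eqP; rewrite subr_eq0; apply/eqP.
  by rewrite -[RHS]addr0; exact: cvg_unique cvg_shift' cvg_shift.
by move/eqP; rewrite mulf_eq0 subr_eq0 eq_sym (negPf pW1) => /eqP.
Qed.

End Absorption.

(** * Limiting distribution and final states *)

Section Limits.
Variables (R : realType) (rho : nat -> nat) (P : lcl) (M : chains R P).
Hypothesis menderM : is_mender rho M.
Variables (n : nat) (G : graph n) (l : labeling (label P) n) (v : 'I_n).
Hypothesis inst : instance G l v.
Implicit Types (W : {set 'I_n}) (k : nat).

Local Notation st := (steps M G l v).

Let v1 : v \in [set v]%SET. Proof. exact: set11. Qed.

Lemma final_reached W : final M G l v W ->
  [/\ v \in W, exists k, W \subset ball G k [set v]%SET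
    & contains_mend G l v W].
Proof.
case/andP=> /asboolP[k /(steps_sub menderM inst v1)/andP[]].
rewrite finset.sub1set => vW W_ball /eqP pW1; split=> //; first by exists k.
exact/(mender_termination menderM inst vW).
Qed.

(** The sequence is nondecreasing because [W] is absorbing, and bounded by the total mass 1; so the
    [limn] in [limit_distribution] is a genuine limit. *)
Lemma limit_cvg W : final M G l v W ->
  (st k [set v]%SET W @[k --> \oo] --> limit_distribution M G l v W)%classic.
Proof.
move=> finW; have [vW _ _] := final_reached finW.
have pW1 : M G l v W W = 1 by case/andP: finW => _ /eqP.
apply: nondecreasing_is_cvgn.
  apply/nondecreasing_seqP => k.
  exact: (steps_absorbing_le menderM inst k v1 vW pW1).
exists 1 => _ [k _ <-].
rewrite -(steps_sum1 menderM inst k v1) (bigD1 W) //= lerDl.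
by apply: sumr_ge0 => A _; exact: (steps_ge0 menderM inst).
Qed.

Lemma limit_ge0 W : final M G l v W -> 0 <= limit_distribution M G l v W.
Proof.
move=> finW; apply: limr_ge; first by apply: cvgP; exact: limit_cvg.
by apply: nearW => k; exact: (steps_ge0 menderM inst).
Qed.

(** Absorbing states that are not final are unreachable and carry no mass at any time, so the sum
    runs in effect over all absorbing states. *)
Lemma sum_final k : \sum_(W | final M G l v W) st k [set v]%SET W =
  1 - transient M G l v k [set v]%SET.
Proof.
rewrite -(steps_sum1 menderM inst k v1).
rewrite [in RHS](bigID (fun A => M G l v A A == 1)) /=.
rewrite addrK [RHS](bigID (final M G l v)) /= [X in _ + X]big1 ?addr0.
  apply: eq_bigl => A; rewrite andbC.
  by case: (boolP (final _ _ _ _ _)) => // /andP[_ ->].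
move=> A /andP[pA1]; rewrite /final pA1 andbT => /asboolP notA.
apply/eqP; rewrite eq_le (steps_ge0 menderM inst) // andbT leNgt.
by apply/negP => stA; apply: notA; exists k.
Qed.

Lemma sum_limit : \sum_(W | final M G l v W) limit_distribution M G l v W = 1.
Proof.
have cvg_sum : (\sum_(W | final M G l v W) st k [set v]%SET W @[k --> \oo] -->
    \sum_(W | final M G l v W) limit_distribution M G l v W)%classic.
  by apply: cvg_big => [|W]; [exact: add_continuous | exact: limit_cvg].
have cvg1 : (\sum_(W | final M G l v W) st k [set v]%SET W @[k --> \oo] -->
    (1 - 0 : R))%classic.
  under eq_fun do rewrite sum_final.
  apply: cvgB; first exact: cvg_cst.
  exact: (transient_cvg0 menderM inst).
by rewrite -[RHS]subr0; exact: cvg_unique cvg_sum cvg1.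
Qed.

(** The total limiting mass 1 rules out an empty set of final states, so the minimum in [MRad] is
    over a nonempty family. *)
Lemma exists_final : exists W, final M G l v W.
Proof.
case: (pickP (final M G l v)) => [W finW|no_final]; first by exists W.
have := sum_limit; rewrite big_pred0 // => /esym/eqP.
by rewrite oner_eq0.
Qed.

(** Every vertex of a reachable state is connected to [v], so [dist] is a true distance here and not
    its default value. *)
Lemma final_sub_ball W : final M G l v W ->
  W \subset ball G (\max_(w in W) dist G v w) [set v]%SET.
Proof.
case/final_reached => _ [k /fintype.subsetP W_ball] _.
apply/fintype.subsetP => w wW; have := mem_ball_dist (W_ball w wW).
apply: (fintype.subsetP (leq_ball _ _ _)).
exact: (@leq_bigmax_cond _ (mem W) (dist G v)).
Qed.

(** Some vertex of a final state is at distance at least [m] from [v], and the balls around [v] grow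
    strictly up to that distance. *)
Lemma radius_lt_card_ball m :
  (m <= \big[minn/n]_(W | final M G l v W) \max_(w in W) dist G v w)%N ->
  (m < #|ball G m [set v]%SET|)%N.
Proof.
move=> m_rad; have [W finW] := exists_final.
have [vW [k /fintype.subsetP W_ball] _] := final_reached finW.
have := leq_trans m_rad (bigminn_le _ _ finW).
have W_gt0 : (0 < #|[pred w in W]|)%N by apply/card_gt0P; exists v.
have [w wW ->] := eq_bigmax_cond (dist G v) W_gt0 => m_dist.
apply: (ltn_card_ball (W_ball w wW)) => i im.
exact: notin_ball_dist (leq_trans im m_dist).
Qed.

End Limits.

(** * Comparison of the measures for one mender *)

Lemma natr_bigmax (R : realType) (I : finType) (Q : pred I) (F : I -> nat) :
  (\max_(i | Q i) F i)%:R = \big[Num.max/0]_(i | Q i) (F i)%:R :> R.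
Proof.
apply: (big_morph (fun k : nat => k%:R : R)) => // a b.
by rewrite /Num.max ltr_nat /maxn; case: ifP.
Qed.

Section Volumes.
Variables (R : realType) (rho : nat -> nat) (P : lcl) (M : chains R P).
Hypothesis menderM : is_mender rho M.
Variables (n : nat) (G : graph n).
Hypothesis G_P : in_class P G.

Lemma ExMVol_le_EMVol : (ExMVol P G)%:R <= EMVol M G :> R.
Proof.
rewrite /ExMVol /EMVol natr_bigmax; apply: le_bigmax2 => l sol_l.
rewrite natr_bigmax; apply: le_bigmax2 => v hole_v.
have inst : instance G l v by rewrite /instance G_P sol_l hole_v.
set m := \big[minn/n]_(_ | _) _.
(* The limiting distribution has mass 1, so [m] is its own average and can be compared with [#|W|]
   state by state: each final [W] contains a mend, which has at least [m] changes. *)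
have -> : m%:R =
    \sum_(W | final M G l v W) limit_distribution M G l v W * m%:R :> R.
  by rewrite -mulr_suml (sum_limit menderM inst) mul1r.
apply: ler_sum => W finW; apply: ler_wpM2l; first exact: (limit_ge0 menderM).
have [_ _ /existsP[l' /andP[mend_l' ch_W]]] := final_reached menderM inst finW.
rewrite ler_nat.
exact: leq_trans (bigminn_le _ _ mend_l') (subset_leq_card ch_W).
Qed.

Lemma EMVol_le_DMVol : EMVol M G <= (DMVol M G)%:R.
Proof.
rewrite /DMVol /EMVol natr_bigmax; apply: le_bigmax2 => l sol_l.
rewrite natr_bigmax; apply: le_bigmax2 => v hole_v.
have inst : instance G l v by rewrite /instance G_P sol_l hole_v.
set m := \max_(_ | _) _.
have -> : m%:R =
    \sum_(W | final M G l v W) limit_distribution M G l v W * m%:R :> R.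
  by rewrite -mulr_suml (sum_limit menderM inst) mul1r.
apply: ler_sum => W finW; apply: ler_wpM2l; first exact: (limit_ge0 menderM).
rewrite ler_nat; exact: (@leq_bigmax_cond _ (final M G l v) (fun W => #|W|)).
Qed.

Lemma DMVol_le : (DMVol M G <= n)%N.
Proof.
apply/bigmax_leqP => l _; apply/bigmax_leqP => v _; apply/bigmax_leqP => W _.
by rewrite -[leqRHS]card_ord max_card.
Qed.

Lemma MRad_le : (MRad M G <= n)%N.
Proof.
apply/bigmax_leqP => l _; apply/bigmax_leqP => v _; exact: bigminn_le_default.
Qed.

End Volumes.

(** A hole of radius [m] has more than [m] vertices within distance [m], hence within
    [MRad_size M n], the radius that [NMRad] uses. *)
Lemma MRad_size_le_NMRad (R : realType) (rho : nat -> nat) (P : lcl)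
    (M : chains R P) (n : nat) : is_mender rho M ->
  (MRad_size M n <= NMRad M n)%N.
Proof.
move=> menderM; rewrite {1}/MRad_size; apply/bigmax_leqP => G G_P.
apply/bigmax_leqP => l sol_l; apply/bigmax_leqP => v hole_v.
have inst : instance G l v by rewrite /instance G_P sol_l hole_v.
set m := \big[minn/n]_(_ | _) _.
have m_size : (m <= MRad_size M n)%N.
  apply: leq_trans (leq_bigmax_cond _ G_P).
  apply: leq_trans (leq_bigmax_cond _ sol_l).
  exact: (@leq_bigmax_cond _ (hole l)).
have := radius_lt_card_ball menderM inst (leqnn m) => /ltnW/leq_trans; apply.
apply: leq_trans (leq_bigmax_cond _ G_P).
apply: leq_trans (leq_bigmax v).
exact/subset_leq_card/leq_ball.
Qed.

Lemma NMRad_le (R : realType) (P : lcl) (M : chains R P) (n : nat) :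
  (NMRad M n <= n)%N.
Proof.
apply/bigmax_leqP => G _; apply/bigmax_leqP => v _.
by rewrite -[leqRHS]card_ord max_card.
Qed.

Lemma NMRad_le_exp (R : realType) (P : lcl) (M : chains R P) (n D : nat) :
  (forall (G : graph n) (x : 'I_n), in_class P G ->
     (#|[set y | adj G x y]%SET| <= D)%N) ->
  (NMRad M n <= D.+1 ^ MRad_size M n)%N.
Proof.
move=> degD; apply/bigmax_leqP => G G_P; apply/bigmax_leqP => v _.
by apply: card_ball => y; exact: degD.
Qed.

(** * The ball mender *)

Section BallMender.
Variables (R : realType) (rho : nat -> nat) (P : lcl).

Definition ball_next n (G : graph n) (l : labeling (label P) n) (v : 'I_n)
    (W : {set 'I_n}) : {set 'I_n} :=
  if contains_mend G l v W then W else cnbhd G W.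

Definition ball_mender : chains R P := fun n G l v W W' =>
  (ball_next G l v W == W')%:R.

(** Since [f] controls adjacency inside [A] only, both closed neighborhoods have to lie where the
    isomorphism acts: the first to map neighbors forward, the second to pull them back. *)
Lemma labeled_iso_cnbhd (L : Type) n m (G : graph n) (G' : graph m)
    (l : 'I_n -> L) (l' : 'I_m -> L) (A : {set 'I_n}) (A' : {set 'I_m})
    (f : 'I_n -> 'I_m) (W : {set 'I_n}) :
  labeled_iso G G' l l' A A' f -> cnbhd G W \subset A ->
  cnbhd G' (f @: W)%SET \subset A' ->
  (f @: cnbhd G W)%SET = cnbhd G' (f @: W)%SET.
Proof.
case=> f_inj f_im f_adj _ /fintype.subsetP WA /fintype.subsetP WA'.
have subA x : x \in W -> x \in A.
  by move=> xW; apply: WA; apply/mem_cnbhd; left.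
apply/setP => y; apply/imsetP/idP => [[x xW ->]|yW].
  apply/mem_cnbhd; have /mem_cnbhd[x'W|[z zW zx]] := xW.
    by left; exact: imset_f.
  right; exists (f z); first exact: imset_f.
  by rewrite (f_adj _ _ (subA z zW) (WA x xW)).
have := WA' _ yW; rewrite -f_im => /imsetP[x xA yE]; exists x => //.
apply/mem_cnbhd.
have /mem_cnbhd[/imsetP[x' x'W fx']|[z /imsetP[x' x'W ->]]] := yW.
  left; suff -> : x = x' by [].
  by apply: f_inj => //; [exact: subA | rewrite -yE].
by rewrite yE f_adj //; [right; exists x' | exact: subA].
Qed.

(* Whether W contains a mend can be read off the transition from W to W of any
   other mender, hence depends only on the surroundings of W. *)
Lemma ball_mender_is_mender (M : chains R P) : (forall r, (0 < rho r)%N) ->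
  is_mender rho M -> is_mender rho ball_mender.
Proof.
move=> rho_gt0 menderM.
have next_gt0 n (G : graph n) l v W W' : 0 < ball_mender G l v W W' ->
    W' = ball_next G l v W.
  by rewrite ltr0n lt0b => /eqP.
split.
- by move=> *; exact: ler0n.
- move=> n G l v W _ _; rewrite (bigD1 (ball_next G l v W)) //= big1 ?addr0.
    by rewrite /ball_mender eqxx.
  by move=> W' /negPf neqW'; rewrite /ball_mender eq_sym neqW'.
- move=> n G l v W W' _ _ /next_gt0 ->; rewrite /ball_next.
  by case: ifP => // _; exact: sub_cnbhd.
- move=> n G l v W W' _ _ /next_gt0 ->; rewrite /ball_next.
  by case: ifP => // _; exact: sub_cnbhd.
- move=> n G l v W inst vW; rewrite /ball_mender /ball_next; case: ifPn.
    by rewrite eqxx.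
  (* A set without a mend that did not grow would be closed and hence contain one. *)
  move=> no_mend; split=> // /eqP; rewrite pnatr_eq1 eqb1 => /eqP closedW.
  by rewrite (closed_contains_mend menderM inst vW closedW) in no_mend.
move=> n m G G' l l' v v' W W' f inst inst' vW vW' iso f_id fv fW X X_ball.
have rho1 := rho_gt0 (vradius P).
have W_ball : W \subset ball G (rho (vradius P)) W by exact: sub_ball.
(* Positivity of [rho] puts the direct neighborhood inside the region that locality reveals. *)
have cW_ball : cnbhd G W \subset ball G (rho (vradius P)) W.
  exact: (leq_ball _ _ rho1).
have cW'_ball : cnbhd G' W' \subset ball G' (rho (vradius P)) W'.
  exact: (leq_ball _ _ rho1).
have mend_eq : contains_mend G l v W = contains_mend G' l' v' W'.
  have := mender_locality menderM inst inst' vW vW' iso f_id fv fW W_ball.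
  rewrite fW => M_eq.
  apply/idP/idP.
    move=> /(mender_termination menderM inst vW) M1.
    by apply/(mender_termination menderM inst' vW'); rewrite -M_eq.
  move=> /(mender_termination menderM inst' vW') M1.
  by apply/(mender_termination menderM inst vW); rewrite M_eq.
have next_ball : ball_next G l v W \subset ball G (rho (vradius P)) W.
  by rewrite /ball_next; case: ifP.
have next_im : ball_next G' l' v' W' = (f @: ball_next G l v W)%SET.
  rewrite /ball_next -mend_eq; case: ifP => // _.
  by rewrite -fW (labeled_iso_cnbhd iso) // fW.
rewrite /ball_mender next_im; congr ((_ : bool)%:R).
apply/eqP/eqP => [->//|fX].
have f_inj := labeled_iso_inj iso.
have sub (A B : {set 'I_n}) : A \subset ball G (rho (vradius P)) W ->
    B \subset ball G (rho (vradius P)) W -> (f @: A)%SET = (f @: B)%SET ->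
    A \subset B.
  move=> /fintype.subsetP A_ball /fintype.subsetP B_ball fAB.
  apply/fintype.subsetP => x xA; have : f x \in (f @: A)%SET by exact: imset_f.
  by rewrite fAB => /imsetP[y yB /f_inj->//]; [exact: A_ball | exact: B_ball].
by apply/eqP; rewrite finset.eqEsubset; apply/andP; split; apply: sub.
Qed.

Section Measures.
Variables (n : nat) (G : graph n).

Lemma steps_ball_mender l v k (W W' : {set 'I_n}) :
  steps ball_mender G l v k W W' = (iter k (ball_next G l v) W == W')%:R.
Proof.
elim: k W => [|k IH] W //=.
rewrite (bigD1 (ball_next G l v W)) //= big1 ?addr0.
  by rewrite IH /ball_mender eqxx mul1r -iterS iterSr.
by move=> U /negPf neqU; rewrite /ball_mender eq_sym neqU mul0r.
Qed.

(** The chain is deterministic and stays in a final state forever, so two final states coincide at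
    the later of their arrival times. *)
Lemma final_ball_mender_uniq l v (W W' : {set 'I_n}) :
  final ball_mender G l v W -> final ball_mender G l v W' -> W = W'.
Proof.
have finalP (U : {set 'I_n}) : final ball_mender G l v U ->
    exists k, forall j, (k <= j)%N ->
      iter j (ball_next G l v) [set v]%SET = U.
  case/andP=> /asboolP[k]; rewrite steps_ball_mender ltr0n lt0b => /eqP Uk.
  rewrite pnatr_eq1 eqb1 => /eqP fixU; exists k => j /subnK <-.
  by rewrite iterD Uk; elim: (j - k)%N => //= i ->.
move=> /finalP[k Wk] /finalP[k' W'k].
by rewrite -(Wk (maxn k k')) ?leq_maxl // W'k ?leq_maxr.
Qed.

Lemma ball_mender_radius_le l v e :
  contains_mend G l v (ball G e [set v]%SET) ->
  (\big[minn/n]_(W | final ball_mender G l v W)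
     \max_(w in W) dist G v w <= e)%N.
Proof.
move=> mend_e.
have ex_e : exists e, contains_mend G l v (ball G e [set v]%SET) by exists e.
(* For the least such [j] no earlier ball contains a mend, so the chain runs through the balls and
   stops at radius [j]. *)
have [j mend_j j_min] := ex_minnP ex_e.
have iter_ball i : (i <= j)%N ->
    iter i (ball_next G l v) [set v]%SET = ball G i [set v]%SET.
  elim: i => // i IH ij; rewrite iterS IH 1?ltnW // /ball_next ifN //.
  by apply: contraL ij => /j_min; rewrite leqNgt.
have final_j : final ball_mender G l v (ball G j [set v]%SET).
  apply/andP; split; last by rewrite /ball_mender /ball_next mend_j eqxx.
  by apply/asboolP; exists j; rewrite steps_ball_mender iter_ball // eqxx ltr01.
apply: leq_trans (bigminn_le _ _ final_j) (leq_trans _ (j_min _ mend_e)).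
by apply/bigmax_leqP => w; exact: dist_leq.
Qed.

Hypothesis G_P : in_class P G.

(** A final state of [M] contains a mend and lies in the ball of its own radius around [v]; that
    ball contains the mend too, so the ball mender stops no later. *)
Lemma MRad_ball_mender_min (M : chains R P) : is_mender rho M ->
  (MRad ball_mender G <= MRad M G)%N.
Proof.
move=> menderM; apply/bigmax_leqP => l sol_l; apply/bigmax_leqP => v hole_v.
have inst : instance G l v by rewrite /instance G_P sol_l hole_v.
apply: leq_trans (leq_bigmax_cond _ sol_l).
apply: leq_trans (leq_bigmax_cond _ hole_v).
apply: leq_bigminn => [|W finW]; first exact: bigminn_le_default.
apply/ball_mender_radius_le/(contains_mendS (final_sub_ball menderM inst finW)).
by have [] := final_reached menderM inst finW.
Qed.

(** A smallest mend, with [m] changes, yields a mend inside the ball of radius [2r * m]. The extra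
    summand [m] pays for the case [m = n], where the radius is trivially at most [n]. *)
Lemma MRad_ball_mender_le_ExMVol :
  (MRad ball_mender G <= (2 * vradius P).+1 * ExMVol P G)%N.
Proof.
apply/bigmax_leqP => l sol_l; apply/bigmax_leqP => v hole_v.
have inst : instance G l v by rewrite /instance G_P sol_l hole_v.
set m := \big[minn/n]_(l' | mend G l v l') #|changes l l'|.
have m_Ex : (m <= ExMVol P G)%N.
  apply: leq_trans (leq_bigmax_cond _ sol_l).
  exact: (@leq_bigmax_cond _ (hole l)).
apply: leq_trans (leq_mul (leqnn _) m_Ex); rewrite mulSn.
(* m may be the default value n of the minimum *)
have [->|m_n] := eqVneq m n.
  exact: leq_trans (bigminn_le_default _ _ _) (leq_addr _ _).
apply: leq_trans (leq_addl _ _).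
have [l' mend_l' ->] : exists2 l', mend G l v l' & m = #|changes l l'|.
  move: m_n; rewrite /m; elim/big_ind: _ => [|a b IHa IHb|l' mend_l' _].
  - by rewrite eqxx.
  - by rewrite /minn; case: ifP.
  - by exists l'.
exact/ball_mender_radius_le/contains_mend_ball.
Qed.

Lemma DMVol_ball_mender_le (D : nat) : is_mender rho ball_mender ->
  (forall x : 'I_n, (#|[set y | adj G x y]%SET| <= D)%N) ->
  (DMVol ball_mender G <= D.+1 ^ MRad ball_mender G)%N.
Proof.
move=> menderB degD; apply/bigmax_leqP => l sol_l.
apply/bigmax_leqP => v hole_v.
apply/bigmax_leqP => W finW.
have inst : instance G l v by rewrite /instance G_P sol_l hole_v.
apply: leq_trans (subset_leq_card (final_sub_ball menderB inst finW)) _.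
apply: leq_trans (card_ball _ _ degD) _; rewrite leq_pexp2l //.
apply: leq_trans (leq_bigmax_cond _ sol_l).
apply: leq_trans (leq_bigmax_cond _ hole_v).
(* As there is only one final state, the minimum in [MRad] also bounds the radius of [W]. *)
apply: leq_bigminn => [|W' finW'].
  by apply/bigmax_leqP => w _; exact: dist_le.
by rewrite (final_ball_mender_uniq finW' finW).
Qed.

End Measures.

Lemma ball_mender_optimal :
  is_mender rho ball_mender -> optimal_mender rho ball_mender.
Proof.
split=> // M menderM n; apply/bigmax_leqP => G G_P.
apply: leq_trans (leq_bigmax_cond _ G_P).
exact: MRad_ball_mender_min.
Qed.

End BallMender.

(** * Worst-case costs against the radius of the ball mender *)

Lemma worst_natr (R : realType) (P : lcl) (F : forall n, graph n -> nat)
    (n : nat) :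
  worst P (fun n G => (F n G)%:R) n = (\max_(G | in_class P G) F n G)%:R :> R.
Proof. by rewrite natr_bigmax. Qed.

Lemma worst_le (R : realType) (P : lcl) (X Y : forall n, graph n -> R)
    (n : nat) :
  (forall G : graph n, in_class P G -> X n G <= Y n G) ->
  worst P X n <= worst P Y n.
Proof. exact: le_bigmax2. Qed.

Section Costs.
Variables (R : realType) (rho : nat -> nat) (P : lcl).
Hypothesis rho_gt0 : forall r, (0 < rho r)%N.

Local Notation B := (@ball_mender R P).

(** The factor is [2r + 1] for the three volumes and 1 for the radius and the neighborhood size; the
    form [K.+1] keeps it positive, so that one can divide by it. *)
Lemma cost_lower (M0 : chains R P) X (f : nat -> R) : is_mender rho M0 ->
  costs rho P X f ->
  exists K : nat, forall n, (MRad_size B n)%:R <= K.+1%:R * f n.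
Proof.
move=> menderM0; have menderB := ball_mender_is_mender rho_gt0 menderM0.
have Ex_lower n : (MRad_size B n)%:R <=
    (2 * vradius P).+1%:R * worst P (fun n G => (ExMVol P G)%:R) n :> R.
  rewrite worst_natr -natrM ler_nat; apply/bigmax_leqP => G G_P.
  apply: leq_trans (MRad_ball_mender_le_ExMVol R G_P) _; rewrite leq_mul2l /=.
  exact: (@leq_bigmax_cond _ (in_class P (n:=n)) (fun G => ExMVol P G)).
have volume_lower (g : nat -> R) :
    (forall n, worst P (fun n G => (ExMVol P G)%:R) n <= g n) ->
    exists K : nat, forall n, (MRad_size B n)%:R <= K.+1%:R * g n.
  move=> Ex_g; exists (2 * vradius P)%N => n.
  apply: le_trans (Ex_lower n) _.
  by rewrite ler_wpM2l.
have Ex_E (M : chains R P) n : is_mender rho M ->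
    worst P (fun n G => (ExMVol P G)%:R) n <= worst P (fun n G => EMVol M G) n.
  by move=> menderM; apply: worst_le => G; exact: (ExMVol_le_EMVol menderM).
case: X => /= [[M menderM <-]|->|[M menderM <-]|[M menderM <-]|[M optM <-]].
- exists 0%N => n; rewrite mul1r worst_natr ler_nat; apply/bigmax_leqP => G G_P.
  apply: leq_trans (MRad_ball_mender_min G_P menderM) _.
  exact: (@leq_bigmax_cond _ (in_class P (n:=n)) (fun G => MRad M G)).
- exact: volume_lower.
- by apply: volume_lower => n; exact: Ex_E.
- apply: volume_lower => n; apply: le_trans (Ex_E M n menderM) _.
  by apply: worst_le => G; exact: (EMVol_le_DMVol menderM).
- exists 0%N => n; rewrite mul1r ler_nat.
  have [menderM _] := optM; have [_ minB] := ball_mender_optimal menderB.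
  exact: leq_trans (minB _ menderM n) (MRad_size_le_NMRad _ menderM).
Qed.

(** The bound [n] serves the linear case, the exponential one the constant case. The base is [D.+2]
    because the radius itself has to stay below the power, which needs a base of at least 2 even if
    [D] is 0. *)
Lemma cost_upper (M0 : chains R P) D X : is_mender rho M0 ->
  (forall n (G : graph n) (x : 'I_n),
    in_class P G -> (#|[set y | adj G x y]%SET| <= D)%N) ->
  exists2 f : nat -> R, costs rho P X f &
    forall n, f n <= n%:R /\ f n <= (D.+2 ^ MRad_size B n)%:R.
Proof.
move=> menderM0 degD; have menderB := ball_mender_is_mender rho_gt0 menderM0.
have DMVol_upper n : worst P (fun n G => (DMVol B G)%:R) n <= n%:R :> R /\
    worst P (fun n G => (DMVol B G)%:R) n <= (D.+2 ^ MRad_size B n)%:R :> R.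
  rewrite worst_natr !ler_nat; split; apply/bigmax_leqP => G G_P.
    exact: DMVol_le.
  apply: leq_trans (DMVol_ball_mender_le G_P menderB _) _.
    by move=> x; apply: leq_trans (degD _ _ x G_P) (leqnSn D).
  rewrite leq_pexp2l //.
  exact: (@leq_bigmax_cond _ (in_class P (n:=n)) (fun G => MRad B G)).
have volume_upper (g : nat -> R) :
    (forall n, g n <= worst P (fun n G => (DMVol B G)%:R) n) ->
    forall n, g n <= n%:R /\ g n <= (D.+2 ^ MRad_size B n)%:R :> R.
  by move=> g_D n; have [? ?] := DMVol_upper n; split;
    exact: le_trans (g_D n) _.
have E_D n : worst P (fun n G => EMVol B G) n <=
    worst P (fun n G => (DMVol B G)%:R) n.
  by apply: worst_le => G; exact: (EMVol_le_DMVol menderB).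
case: X => /=.
- eexists; first by exists B.
  move=> n; rewrite worst_natr !ler_nat; split.
    by apply/bigmax_leqP => G _; exact: MRad_le.
  exact/ltnW/ltn_expl.
- eexists; first by [].
  apply: volume_upper => n; apply: le_trans (E_D n).
  by apply: worst_le => G; exact: (ExMVol_le_EMVol menderB).
- by eexists; [by exists B | exact: volume_upper].
- by eexists; [by exists B | exact: volume_upper].
- eexists; first by exists B => //; exact: ball_mender_optimal.
  move=> n; rewrite !ler_nat NMRad_le; split=> //.
  apply: NMRad_le_exp => G x G_P.
  exact: leq_trans (degD _ _ x G_P) (leqnSn D).
Qed.

(** * Orders of growth *)

Hypothesis degP : bounded_degree P.

Let large_filter : Filter (large_sizes P).
Proof. exact: within_filter. Qed.

Lemma Theta_linear : is_Theta rho P mMRad (fun n => n%:R : R) ->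
  forall X, is_Theta rho P X (fun n => n%:R : R).
Proof.
have [D degD] := degP => -[[_ [M menderM _] _] lower] X; split.
  have [f cost_f f_le] := cost_upper X menderM degD; exists f => //.
  exists 1; apply: filterE => n; rewrite mul1r; exact: (f_le n).1.
move=> f /(cost_lower menderM)[K K_f].
(* The lower bound holds for every mender, in particular for the ball mender, whose radius bounds
   [f] from below by [K_f]. *)
have [|c c_gt0 c_B] := lower (fun n => (MRad_size B n)%:R).
  exists B; first exact: ball_mender_is_mender menderM.
  by apply/funext => n; rewrite worst_natr.
exists (c / K.+1%:R); first by rewrite divr_gt0.
apply: filterS c_B => n c_n; rewrite mulrAC ler_pdivrMr // mulrC.
by rewrite (mulrC _ c) (mulrC (f n)); exact: le_trans c_n (K_f n).
Qed.

Lemma O_constant : is_O rho P mMRad (fun=> 1 : R) ->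
  forall X, is_O rho P X (fun=> 1 : R).
Proof.
have [D degD] := degP => -[_ [M menderM <-] [C M_C]] X.
have [f cost_f f_le] := cost_upper X menderM degD; exists f => //.
(* By optimality the radius of the ball mender is at most that of [M], hence an integer at most
   [C]. *)
exists (D.+2 ^ Num.truncn C)%:R; apply: filterS M_C => n.
rewrite !mulr1 worst_natr => M_C.
apply: le_trans (f_le n).2 _; rewrite ler_nat leq_pexp2l //.
have [_ minB] := ball_mender_optimal (ball_mender_is_mender rho_gt0 menderM).
apply: leq_trans (minB M menderM n) _.
by rewrite truncn_ge_nat // (le_trans _ M_C).
Qed.

Lemma O_constant_equivalent X Y : (forall Z, is_O rho P Z (fun=> 1 : R)) ->
  asymptotically_equivalent R rho P X Y.
Proof.
move=> O1; split=> T T_lim.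
  suff OT Z : is_O rho P Z T by split.
  (* Since [T] is at least 1, a constant bound is also a bound by a multiple of [T]. *)
  have [f cost_f [C f_C]] := O1 Z; exists f => //; exists `|C|.
  apply: filterS f_C => n; rewrite mulr1 => /le_trans; apply.
  by apply: le_trans (ler_norm C) _; rewrite ler_peMr.
(* A measure that is O(1) is Omega of an unbounded T only if P has no
   instances of large size; then everything is Omega(T). *)
suff Omega_eq Z Z' : is_Omega rho P Z T -> is_Omega rho P Z' T.
  by split; exact: Omega_eq.
move=> Omega_Z; have [f cost_f [C f_C]] := O1 Z.
have [c c_gt0 c_f] := Omega_Z f cost_f.
have T_C : \forall n \near large_sizes P, C / c < T n.
  by apply: cvg_within; apply: cvgry_gt T_lim _.
move=> g _; exists 1 => //.
apply: filterS (filterI (filterI f_C c_f) T_C) => n [[]].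
rewrite mulr1 => fn cn.
by rewrite ltr_pdivrMr // mulrC ltNge (le_trans cn fn).
Qed.

Lemma Theta_linear_equivalent X Y :
  (forall Z, is_Theta rho P Z (fun n => n%:R : R)) ->
  asymptotically_equivalent R rho P X Y.
Proof.
move=> Theta_n; split=> T T_lim.
  suff O_sub Z Z' : is_O rho P Z T -> is_O rho P Z' T by split; exact: O_sub.
  (* From [c * n <= f n <= C * T n] follows [n <= C / c * T n], and [Z'] has a cost of at most
     [C' * n]. *)
  case=> f cost_f [C f_C]; have [_ /(_ f cost_f)[c c_gt0 c_f]] := Theta_n Z.
  have [[g cost_g [C' g_C']] _] := Theta_n Z'.
  exists g => //; exists (`|C'| * (C / c)).
  apply: filterS (filterI (filterI f_C c_f) g_C') => n [[fn cn] gn].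
  apply: le_trans gn _; apply: le_trans (ler_wpM2r _ (ler_norm C')) _ => //.
  rewrite -mulrA ler_wpM2l // mulrAC ler_pdivlMr // mulrC.
  exact: le_trans cn fn.
suff Omega_sub Z Z' : is_Omega rho P Z T -> is_Omega rho P Z' T.
  by split; exact: Omega_sub.
move=> Omega_Z; have [[f cost_f [C f_C]] _] := Theta_n Z.
have [c c_gt0 c_f] := Omega_Z f cost_f.
have [_ Omega_Z'] := Theta_n Z'.
move=> g cost_g; have [c' c'_gt0 c'_g] := Omega_Z' g cost_g.
(* Here [c * T n <= f n <= C * n] bounds [n] from below. As [C] may fail to be positive, it is
   replaced by a positive upper bound before dividing. *)
have C1_gt0 : 0 < `|C| + 1 by rewrite ltr_wpDl.
exists (c' * (c / (`|C| + 1))); first by rewrite mulr_gt0 ?divr_gt0.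
apply: filterS (filterI (filterI f_C c_f) c'_g) => n [[fn cn] gn].
apply: le_trans gn; rewrite -mulrA ler_pM2l // mulrAC ler_pdivrMr //.
apply: le_trans cn (le_trans fn _); rewrite mulrC ler_wpM2l //.
by rewrite (le_trans (ler_norm C)) // lerDl.
Qed.

End Costs.

Theorem mainTheorem5 (R : realType) (rho : nat -> nat)
    (rho_gt0 : forall r, (0 < rho r)%N) (P : lcl)
    (degP : bounded_degree P) (mendP : mends_exist P) :
  (is_Theta rho P mMRad (fun n => n%:R : R) ->
     forall X, is_Theta rho P X (fun n => n%:R : R)) /\
  (is_O rho P mMRad (fun=> 1 : R) ->
     forall X, is_O rho P X (fun=> 1 : R)) /\
  (MRad_dichotomy R rho -> on_paths_and_cycles P ->
     forall X Y, asymptotically_equivalent R rho P X Y).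
Proof.
split; first exact: Theta_linear.
split; first exact: O_constant.
move=> dichotomy pathsP X Y; have [MRad_O1|Theta_n] := dichotomy P mendP pathsP.
  by apply: O_constant_equivalent; exact: O_constant.
by apply: Theta_linear_equivalent; exact: Theta_linear.
Qed.
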